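(* Fix $\alpha\in(0,1)$. Let $(\lambda_n)_{n\ge 1}\subset(0,1)$ satisfy $\frac{n\lambda_n}{\log n}\to\infty$ and $\lambda_n=o\left(\frac{1}{\log n}\right)$ as $n\to\infty$. Let $f:[-1/2,1/2)\to\mathbb R$ be continuous with $\lim_{\nu\to 1/2}f(\nu)=f(-1/2)$ and $\operatorname{ess\,inf}_{\nu\in[-1/2,1/2)}f(\nu)>0$, with Fourier coefficients $f_h=\int_{-1/2}^{1/2}f(u)e^{-2\pi i h u}\,du$ satisfying $|f_h|\le C(1+|h|)^{-(1+\kappa)}$, $h\in\mathbb Z$, for some constants $C>0$, $\kappa>0$, and let $\Sigma_n=(f_{j-i})_{1\le i,j\le n}$ be a covariance matrix for each $n\geq 1$. For $I\in\mathcal I(\lambda_n)$ put $\sigma_n(I)=\mathbf 1_I^T\Sigma_n\mathbf 1_I$. Assume in addition that for all sufficiently large $n$ $$\Delta_n\inf_{I\in\mathcal I(\lambda_n)}\frac{\lfloor n\lambda_n\rfloor}{\sqrt{\sigma_n(I)}}\ \ge\ (\sqrt2+\tilde\varepsilon_n)\sqrt{-\log\lambda_n},$$ where $(\tilde\varepsilon_n)_{n\in\mathbb N}$ is a sequence of real numbers with $\tilde\varepsilon_n\to0$ and $\tilde\varepsilon_n\sqrt{-\log\lambda_n}-\sqrt{\log\log n}\to\infty$ as $n\to\infty$. Then there are thresholds $c_{\alpha,n}$ such that the tests $$\Phi_n^{\mathrm a}(Y)=\begin{cases}1&\text{if }\sup_{I\in\mathcal I(\lambda_n)}\frac{|\mathbf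 1_I^TY|}{\sqrt{\mathbf 1_I^T\Sigma_n\mathbf 1_I}}>c_{\alpha,n},\\0&\text{else,}\end{cases}$$ satisfy $\bar\alpha(\Phi_n^{\mathrm a})\le\alpha$ for all $n\in\mathbb N$ and $\limsup_{n\to\infty}\bar\beta(\Phi_n^{\mathrm a})\le\alpha$.
   Context: The testing problem is $H_0:Y\sim\mathcal N_n(0,\Sigma_n)$ against $H_1^n:\exists I\in\mathcal I(\lambda_n),\exists\delta\in\mathbb R,|\delta|\ge\Delta_n$ with $Y\sim\mathcal N_n(\delta\mathbf 1_I,\Sigma_n)$, where $\Delta_n>0$ and $\Sigma_n,\lambda_n$ are known. For an interval $I\subset[0,1]$, $\mathbf 1_I\in\mathbb R^n$ is the vector with entries $\mathbf 1_I(i)=1$ if $\frac in\in I$ and $0$ otherwise, $1\le i\le n$. For $\lambda\in(0,1)$, $\mathcal I(\lambda)=\{[a,b):0\le a<b\le1,\ b-a=\lambda\}$. In the supremum defining the test, intervals with $\mathbf 1_I=0$ are disregarded (there are none once $n\lambda_n>1$, hence none for large $n$). Let $\mathbb P_0$ and $\mathbb P_{I,\delta}$ denote the laws $\mathcal N_n(0,\Sigma_n)$ and $\mathcal N_n(\delta\mathbf 1_I,\Sigma_n)$ of $Y$. The errors are $\bar\alpha(\Phi_n)=\mathbb P_0[\Phi_n(Y)=1]$ and $\bar\beta(\Phi_n)=\sup_{I\in\mathcal I(\lambda_n)}\sup_{|\delta|\ge\Delta_n}\mathbb P_{I,\delta}[\Phi_n(Y)=0]$. *)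

(* Defs.v *)
From mathcomp Require Import all_boot all_order all_algebra.
From mathcomp Require Import all_classical all_reals all_analysis.
From mathcomp Require Import ess_sup_inf.
From mathcomp.real_closed Require Import complex.

Set Implicit Arguments.
Unset Strict Implicit.
Unset Printing Implicit Defensive.

Import Order.TTheory GRing.Theory Num.Theory.
Import numFieldNormedType.Exports.

Local Open Scope classical_set_scope.
Local Open Scope ring_scope.
Local Open Scope complex_scope.

(* The Fourier integral is split into its real and imaginary parts because
   the library integrates real-valued functions only. *)
Definition fourier_coef {R : realType} (f : R -> R) (h : int) : R[i] :=
  Rintegral lebesgue_measure `[- 2^-1, 2^-1]
    (fun u => f u * cos (2 * pi * h%:~R * u))
  -i*
  Rintegral lebesgue_measure `[- 2^-1, 2^-1]
    (fun u => f u * sin (2 * pi * h%:~R * u)).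

Definition is_covariance {R : realType} n (S : 'M[R]_n) : Prop :=
  S^T = S /\ forall a : 'cV[R]_n, 0 <= (a^T *m S *m a) 0 0.

Definition intervals {R : realType} (lam : R) : set (set R) :=
  [set I | exists a b : R,
     [/\ 0 <= a, a < b, b <= 1, b - a = lam & I = `[a, b[%classic]].

(* Coordinates are numbered 0, ..., n - 1, hence the shift i.+1. *)
Definition ind {R : realType} n (I : set R) : 'cV[R]_n :=
  \col_(i < n) \1_I (i.+1%:R / n%:R).

Definition sigma {R : realType} n (S : 'M[R]_n) (I : set R) : R :=
  ((ind n I)^T *m S *m ind n I) 0 0.

(* The sample space R^n is [n.-tuple R], the type that carries the product
   (Borel) sigma-algebra; [vec] moves an observation to linear algebra. *)
Definition vec {R : realType} n (y : n.-tuple R) : 'cV[R]_n :=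
  \col_(i < n) tnth y i.

(* [normal_prob m 0] is by convention uniform on [0, 1], so the degenerate
   normal law has to be given separately. *)
Definition normal_law {R : realType} (m v : R) (A : set R) : \bar R :=
  if v == 0 then \d_m A else normal_prob m (Num.sqrt v) A.

(* P is the law N_n(mu, S): every linear combination a^T Y of the coordinates
   is normal with mean a^T mu and variance a^T S a.  This determines P. *)
Definition is_gaussian {R : realType} n (mu : 'cV[R]_n) (S : 'M[R]_n)
    (P : probability (n.-tuple R) R) : Prop :=
  forall (a : 'cV[R]_n) (A : set R), measurable A ->
    P [set y | A ((a^T *m vec y) 0 0)] =
    normal_law ((a^T *m mu) 0 0) ((a^T *m S *m a) 0 0) A.

(* The supremum is taken in \bar R, so it is -oo (and the test accepts) when
   1_I = 0 for every admissible I. *)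
Definition scan_stat {R : realType} n (S : 'M[R]_n) (lam : R)
    (y : n.-tuple R) : \bar R :=
  ereal_sup [set (`| ((ind n I)^T *m vec y) 0 0 |
                  / Num.sqrt (sigma S I))%:E
            | I in [set I | intervals lam I /\ ind n I != 0]].

(* true stands for the value 1 (rejection), false for the value 0. *)
Definition scan_test {R : realType} n (S : 'M[R]_n) (lam c : R)
    (y : n.-tuple R) : bool :=
  (c%:E < scan_stat S lam y)%E.

Definition alpha_err {R : realType} n
    (P : 'cV[R]_n -> probability (n.-tuple R) R)
    (Phi : n.-tuple R -> bool) : \bar R :=
  P 0 [set y | Phi y = true].

Definition beta_err {R : realType} n
    (P : 'cV[R]_n -> probability (n.-tuple R) R) (lam Delta : R)
    (Phi : n.-tuple R -> bool) : \bar R :=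
  ereal_sup [set
    ereal_sup [set P (delta *: ind n I) [set y | Phi y = false]
              | delta in [set delta : R | Delta <= `|delta|]]
  | I in intervals lam].

(* Main.v *)
Require Import Defs.
From mathcomp Require Import all_boot all_order all_algebra.
From mathcomp Require Import all_classical all_reals all_analysis.
From mathcomp Require Import measurable_realfun ess_sup_inf.
From mathcomp.real_closed Require Import complex.
From mathcomp Require Import ring lra zify.

Set Implicit Arguments.
Unset Strict Implicit.
Unset Printing Implicit Defensive.

Import Order.TTheory GRing.Theory Num.Theory.
Import numFieldNormedType.Exports.

Local Open Scope classical_set_scope.
Local Open Scope ring_scope.
Local Open Scope complex_scope.

(** Why the scan test works.

    Write X_I for the statistic of the interval I divided by its standard
    deviation, L for -ln lambda_n and l for ln ln n.  The threshold used here is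
    sqrt (2 L) + sqrt l + K, with K depending only on alpha and on the spectral
    density f.

    Size.  A union bound over all of the order of n different indicators would
    cost sqrt (2 ln n), which is too much.  Instead, intervals are compared with a
    coarse grid of starting points of step r, of order n lambda_n / ln n.  The grid
    has of order ln n / lambda_n members, each X being standard normal, so the
    maximum over the grid exceeds sqrt (2 L) + sqrt l + K1 with probability of
    order exp (- K1 ^ 2 / 2): indeed half the square of this level is at least
    L + l + K1 ^ 2 / 2, because l <= L.  An interval I and its neighbour J on the
    grid differ in O(r) points out of n lambda_n, so X_I - X_J has variance
    O(1 / ln n) (normalized_diff_variance), and a union bound over all I shows that
    with high probability these differences are all below a constant tau.  Both comparisons of
    variances with numbers of points come from the spectral density: almost
    everywhere f lies between two positive constants c and M, hence the quadratic form of the Toeplitz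
    matrix lies between c |v|^2 and M |v|^2 (covariance_spectral_bounds).

    Power.  Under the alternative, X_I for the true interval I is normal with
    variance 1 and a mean of modulus at least (sqrt 2 + eps) sqrt L - 1 (the 1 pays
    for the points lost at the boundary of [0, 1]).  This exceeds the threshold by
    eps sqrt L - sqrt l - O(1), which tends to infinity, so the test accepts with a
    probability that eventually drops below alpha.

    Finally, for the finitely many n at which the explicit threshold need not
    have level alpha, any threshold of level alpha is taken
    (exists_level_threshold). *)

(** * Gaussian tails and the union bound *)

(** Beyond m + d, the density centred at m is smaller than the one centred at
    m + d by at least the factor exp (- d ^ 2 / (2 s ^ 2)), since
    (y + d) ^ 2 = y ^ 2 + d ^ 2 + 2 y d and the last term is nonnegative there. *)
Lemma normal_pdf_shift (R : realType) (m d s x : R) : s != 0 -> 0 <= (x - m - d) * d ->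
  normal_pdf m s x <= expR (- d ^+ 2 / (s ^+ 2 *+ 2)) * normal_pdf (m + d) s x.
Proof.
move=> s0 hd; rewrite !normal_pdfE// mulrCA ler_wpM2l ?normal_peak_ge0//.
rewrite /normal_fun -expRD ler_expR -mulrDl ler_wpM2r//.
  by rewrite invr_ge0 mulrn_wge0// sqr_ge0.
nra.
Qed.

(** A tail bound without any integral to evaluate: the shifted normal
    law is again a probability, so its mass on A is at most 1. *)
Lemma normal_prob_shift (R : realType) (m d s : R) (A : set R) : s != 0 -> measurable A ->
  (forall x, A x -> 0 <= (x - m - d) * d) ->
  (normal_prob m s A <= (expR (- d ^+ 2 / (s ^+ 2 *+ 2)))%:E)%E.
Proof.
move=> s0 mA hA.
have mpdf a : measurable_fun A (EFin \o normal_pdf a s).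
  by apply/measurable_funTS/measurable_EFinP; exact: measurable_normal_pdf.
apply: (@le_trans _ _ (\int[lebesgue_measure]_(x in A)
   ((expR (- d ^+ 2 / (s ^+ 2 *+ 2)))%:E * (normal_pdf (m + d) s x)%:E))%E).
  apply: ge0_le_integral => //=.
  - by move=> x _; rewrite lee_fin normal_pdf_ge0.
  - exact: mpdf.
  - by apply: measurable_funeM; exact: mpdf.
  - by move=> x Ax; rewrite -(@EFinM R) lee_fin normal_pdf_shift// hA.
rewrite ge0_integralZl//=; last 2 first.
- exact: mpdf.
- by move=> x _; rewrite lee_fin normal_pdf_ge0.
rewrite -[leRHS]mule1 lee_wpmul2l ?lee_fin ?expR_ge0//.
exact: (@probability_le1 _ _ _ (normal_prob (m + d) s)).
Qed.

(** The bound w on the variance may exceed v, so that the degenerate law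
    v = 0 is covered by the same estimate. *)
Lemma normal_law_tail (R : realType) (m v w t : R) : 0 <= v -> v <= w -> 0 < w -> 0 < t ->
  (normal_law m v [set x : R | (t <= `|x - m|)%R] <= (2 * expR (- t ^+ 2 / (w *+ 2)))%:E)%E.
Proof.
move=> v0 vw w0 t0; rewrite /normal_law.
case: eqVneq => [_|vn0].
  rewrite diracE memNset ?lee_fin ?mulr_ge0 ?expR_ge0//=.
  by rewrite subrr normr0 leNgt t0.
have vp : 0 < v by rewrite lt_neqAle eq_sym vn0.
have sn0 : Num.sqrt v != 0 by rewrite gt_eqF ?sqrtr_gt0.
have mitv (i : interval R) : measurable [set` i] by exact: measurable_itv.
have -> : [set x | t <= `|x - m|] = `]-oo, m - t] `|` `[m + t, +oo[.
  apply/seteqP; split=> x /=; rewrite !in_itv/= andbT ler_normr.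
    by case/orP => h; [right|left]; lra.
  by move=> h; apply/orP; case: h => h; [right|left]; lra.
apply: (le_trans (measureU2 _ _ _)) => //=.
have bound (d : R) : d ^+ 2 = t ^+ 2 ->
   expR (- d ^+ 2 / (Num.sqrt v ^+ 2 *+ 2)) <= expR (- t ^+ 2 / (w *+ 2)).
  move=> ->; rewrite sqr_sqrtr// ler_expR !mulNr lerN2 ler_wpM2l ?sqr_ge0//.
  by rewrite lef_pV2 ?posrE ?pmulrn_lgt0// lerMn2r vw orbT.
rewrite mulrDl mul1r EFinD leeD//.
  apply: (@le_trans _ _ (expR (- (- t) ^+ 2 / (Num.sqrt v ^+ 2 *+ 2)))%:E).
    by apply: normal_prob_shift => // x; rewrite /= in_itv/= => h; nra.
  by rewrite lee_fin bound// sqrrN.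
apply: (@le_trans _ _ (expR (- t ^+ 2 / (Num.sqrt v ^+ 2 *+ 2)))%:E).
  by apply: normal_prob_shift => // x; rewrite /= in_itv/= andbT => h; nra.
by rewrite lee_fin bound.
Qed.

Lemma measurable_dotvec (R : realType) n (a : 'cV[R]_n) :
  measurable_fun [set: n.-tuple R] (fun y : n.-tuple R => (a^T *m vec y) 0 0).
Proof.
rewrite (_ : (fun _ => _) = fun y => \sum_(i < n) a i 0 * tnth y i); last first.
  by apply/funext => y; rewrite mxE; apply: eq_bigr => i _; rewrite !mxE.
apply: measurable_sum => i; apply: measurable_funM => //.
exact: measurable_tnth.
Qed.

Lemma measurable_absdot_gt (R : realType) n (a : 'cV[R]_n) (k s : R) :
  measurable [set y : n.-tuple R | k < `|(a^T *m vec y) 0 0| / s].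
Proof.
rewrite -[X in measurable X]setTI.
have m1 : measurable_fun [set: n.-tuple R] (fun y => `|(a^T *m vec y) 0 0| / s).
  apply: measurable_funM => //; apply: measurableT_comp => //.
  exact: measurable_dotvec.
have := m1 measurableT _ (measurable_itv `]k, +oo[).
by congr (measurable (_ `&` _)); apply/seteqP; split => y /=; rewrite in_itv/= andbT.
Qed.

Lemma measurable_absdot_ge (R : realType) n (a : 'cV[R]_n) (m t : R) :
  measurable [set y : n.-tuple R | t <= `|(a^T *m vec y) 0 0 - m|].
Proof.
rewrite -[X in measurable X]setTI.
have m1 : measurable_fun [set: n.-tuple R] (fun y => `|(a^T *m vec y) 0 0 - m|).
  apply: measurableT_comp => //; apply: measurable_funB => //.
  exact: measurable_dotvec.
have := m1 measurableT _ (measurable_itv `[t, +oo[).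
by congr (measurable (_ `&` _)); apply/seteqP; split => y /=; rewrite in_itv/= andbT.
Qed.

Lemma measurable_abs_ge (R : realType) (m t : R) :
  measurable [set x : R | t <= `|x - m|].
Proof.
rewrite -[X in measurable X]setTI.
have m1 : measurable_fun [set: R] (fun y => `|y - m|).
  by apply: measurableT_comp => //; apply: measurable_funB.
have := m1 measurableT _ (measurable_itv `[t, +oo[).
by congr (measurable (_ `&` _)); apply/seteqP; split => y /=; rewrite in_itv/= andbT.
Qed.

Lemma gaussian_tail (R : realType) n (mu : 'cV[R]_n) (S : 'M[R]_n)
    (P : probability (n.-tuple R) R) (a : 'cV[R]_n) (w t : R) :
  is_gaussian mu S P -> is_covariance S ->
  (a^T *m S *m a) 0 0 <= w -> 0 < w -> 0 < t ->
  (P [set y | (t <= `|(a^T *m vec y) 0 0 - (a^T *m mu) 0 0|)%R]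
    <= (2 * expR (- t ^+ 2 / (w *+ 2)))%:E)%E.
Proof.
move=> gP [_ psd] aw w0 t0.
have := gP a _ (measurable_abs_ge ((a^T *m mu) 0 0) t).
move=> /= ->; exact: normal_law_tail.
Qed.

(** The law enters only through its one-dimensional marginals.  One index type
    carries forms with different variances and levels, so that the grid and the
    differences can be treated in a single application. *)
Lemma gaussian_union_bound (R : realType) n (S : 'M[R]_n) (P : probability (n.-tuple R) R)
    (I : finType) (a : I -> 'cV[R]_n) (w t : I -> R) (E : set (n.-tuple R)) :
  is_gaussian 0 S P -> is_covariance S ->
  (forall i, ((a i)^T *m S *m a i) 0 0 <= w i) ->
  (forall i, 0 < w i) -> (forall i, 0 < t i) ->
  measurable E ->
  (forall y, E y -> exists i, t i <= `|((a i)^T *m vec y) 0 0|) ->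
  (P E <= (\sum_i 2 * expR (- t i ^+ 2 / (w i *+ 2)))%:E)%E.
Proof.
move=> gP cS aw w0 t0 mE hE.
pose F i := [set y : n.-tuple R | t i <= `|((a i)^T *m vec y) 0 0 - ((a i)^T *m (0 : 'cV_n)) 0 0|].
have mF i : measurable (F i) by exact: measurable_absdot_ge.
pose U := \big[setU/set0]_i F i.
have [mU PU] : measurable U /\
    (P U <= (\sum_i 2 * expR (- t i ^+ 2 / (w i *+ 2)))%:E)%E.
  rewrite /U; elim/big_rec2: _ => [|i s V _ [mV PV]]; first by rewrite measure0.
  split; first exact: measurableU.
  rewrite (le_trans (measureU2 _ _ _))// EFinD leeD//.
  exact: (gaussian_tail (a := a i) gP cS).
apply: le_trans PU; apply: le_measure; rewrite ?inE// => y /hE[i hi].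
rewrite /U (bigD1 i)//=; left.
by rewrite /F/= mulmx0 [X in _ - X]mxE subr0.
Qed.

(** * Quadratic forms and normalization *)

Definition qform {R : realType} n (S : 'M[R]_n) (x y : 'cV[R]_n) : R :=
  (x^T *m S *m y) 0 0.

Lemma qform_ge0 (R : realType) n (S : 'M[R]_n) (x : 'cV[R]_n) :
  is_covariance S -> 0 <= qform S x x.
Proof. by case=> _; apply. Qed.

Lemma qformZ (R : realType) n (S : 'M[R]_n) (k : R) (x : 'cV[R]_n) :
  qform S (k *: x) (k *: x) = k ^+ 2 * qform S x x.
Proof.
have trE : (k *: x)^T = k *: x^T by rewrite linearZ.
by rewrite /qform trE -!scalemxAl -!scalemxAr scalerA mxE expr2.
Qed.

(** Since x / 0 = 0, a form of variance 0 is normalized to 0. *)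
Definition normalize {R : realType} n (S : 'M[R]_n) (x : 'cV[R]_n) : 'cV[R]_n :=
  (Num.sqrt (qform S x x))^-1 *: x.

Lemma normalize_dot (R : realType) n (S : 'M[R]_n) (x y : 'cV[R]_n) :
  ((normalize S x)^T *m y) 0 0 = (x^T *m y) 0 0 / Num.sqrt (qform S x x).
Proof.
have trE : (normalize S x)^T = (Num.sqrt (qform S x x))^-1 *: x^T.
  by rewrite /normalize linearZ.
by rewrite trE -scalemxAl mxE mulrC.
Qed.

Lemma normalize_var (R : realType) n (S : 'M[R]_n) (x : 'cV[R]_n) :
  is_covariance S -> qform S (normalize S x) (normalize S x) <= 1.
Proof.
move=> cS; rewrite qformZ exprVn sqr_sqrtr ?qform_ge0//.
have [->|x0] := eqVneq (qform S x x) 0; first by rewrite mulr0.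
by rewrite mulVf.
Qed.

Lemma absdot_normalize (R : realType) n (S : 'M[R]_n) (x y : 'cV[R]_n) :
  `|(x^T *m y) 0 0| / Num.sqrt (qform S x x) = `|((normalize S x)^T *m y) 0 0|.
Proof. by rewrite normalize_dot normrM normfV (ger0_norm (sqrtr_ge0 _)). Qed.

(** With A, B the norms of w and u, the left side is
    2 - 2 <w, u> / (A B), while |w - u| ^ 2 = A ^ 2 + B ^ 2 - 2 <w, u> is at least
    2 A B - 2 <w, u>. *)
Lemma normalized_diff_variance (R : realType) n (S : 'M[R]_n) (w u : 'cV[R]_n) :
  is_covariance S -> 0 < qform S w w -> 0 < qform S u u ->
  qform S (normalize S w - normalize S u) (normalize S w - normalize S u)
  <= qform S (w - u) (w - u) / (Num.sqrt (qform S w w) * Num.sqrt (qform S u u)).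
Proof.
rewrite /normalize => -[sS _] w0 u0.
have qC x y : qform S x y = qform S y x.
  rewrite /qform -[in RHS](trmxK (_ *m _)) [RHS]mxE !trmx_mul trmxK sS mulmxA//.
have qlin k x l y : qform S (k *: x - l *: y) (k *: x - l *: y)
    = k ^+ 2 * qform S x x + l ^+ 2 * qform S y y - 2 * k * l * qform S x y.
  have -> : 2 * k * l * qform S x y = k * l * (qform S x y + qform S y x).
    by rewrite (qC y x); ring.
  have trE : (k *: x - l *: y)^T = k *: x^T - l *: y^T by rewrite linearB/= !linearZ.
  rewrite /qform trE !(mulmxBl, mulmxBr) -!scalemxAl -!scalemxAr.
  have subE (A B : 'M[R]_1) : (A - B) 0 0 = A 0 0 - B 0 0 by rewrite !mxE.
  have sclE (s : R) (A : 'M[R]_1) : (s *: A) 0 0 = s * A 0 0 by rewrite mxE.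
  rewrite !subE !sclE.
  ring.
set A := Num.sqrt (qform S w w); set B := Num.sqrt (qform S u u).
have A0 : 0 < A by rewrite sqrtr_gt0.
have B0 : 0 < B by rewrite sqrtr_gt0.
have AE : qform S w w = A ^+ 2 by rewrite sqr_sqrtr// ltW.
have BE : qform S u u = B ^+ 2 by rewrite sqr_sqrtr// ltW.
have := qlin 1 w 1 u; rewrite !scale1r => ->.
rewrite qlin AE BE ler_pdivlMr ?mulr_gt0//.
have -> : (A^-1 ^+ 2 * A ^+ 2 + B^-1 ^+ 2 * B ^+ 2 - 2 * A^-1 * B^-1 * qform S w u) * (A * B)
  = 2 * A * B - 2 * qform S w u by field; rewrite !gt_eqF.
have := sqr_ge0 (A - B); nra.
Qed.

(** * The spectrum of a Toeplitz covariance matrix *)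

(** A real constant is extracted because the essential infimum is an
    extended real, possibly infinite. *)
Lemma ess_inf_pos_bound (R : realType) (D : set R) (mD : measurable D) (f : R -> R) :
  (0 < ess_inf (mrestr lebesgue_measure mD) (EFin \o f))%E ->
  exists2 c : R, 0 < c & {ae lebesgue_measure, forall u, D u -> c <= f u}.
Proof.
move=> pos.
have [c c0 cf] : exists2 c : R, 0 < c &
    (c%:E <= ess_inf (mrestr lebesgue_measure mD) (EFin \o f))%E.
  move: pos; case: (ess_inf _ _) => [r| |] // r0.
    by exists r; rewrite // -lte_fin.
  by exists 1 => //; rewrite leey.
exists c => //.
have /ess_infP[N [mN N0 hN]] := cf.
exists (N `&` D); split; [exact: measurableI| exact: N0 |].
move=> u /= /not_implyP[Du ncf]; split => //; apply: hN => /=.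
by rewrite lee_fin.
Qed.

(** Replacing f by max (c, f), and by the left limit of this function at b, changes
    it only on a null set: the Fourier coefficients are the same, and the new function
    is continuous on a compact interval and bounded below by c everywhere, not only
    almost everywhere. *)
Lemma spectral_regularize (R : realType) (a b : R) (f : R -> R) :
  a < b ->
  {within `[a, b[, continuous f} -> f x @[x --> b^'-] --> f a ->
  (0 < ess_inf
     (mrestr lebesgue_measure (measurable_itv `[a, b[))%R (EFin \o f))%E ->
  exists c M : R, exists g : R -> R,
  [/\ 0 < c, {within `[a, b], continuous g},
      forall u, u \in `[a, b] -> c <= g u <= M &
      forall phi : R -> R, continuous phi ->
        \int[lebesgue_measure]_(u in `[a, b]) (f u * phi u) =
        \int[lebesgue_measure]_(u in `[a, b]) (g u * phi u)].
Proof.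
move=> ab cf fb /ess_inf_pos_bound[c c0 caef].
(* g is fc with its value at b forced to be the limit fc a. *)
pose fc u := Num.max c (f u).
pose g u := if u < b then fc u else fc a.
have gfc u : u \in `[a, b[ -> g u = fc u by rewrite in_itv/= /g => /andP[_ ->].
have cfc : {within `[a, b[, continuous fc}.
  by move=> x; apply: continuous_max; [exact: cvg_cst|exact: cf].
have cg : {within `[a, b], continuous g}.
  apply/continuous_within_itvP => //; split.
  - move=> x xab.
    have cx : {for x, continuous fc}.
      have : {within `]a, b[, continuous fc}.
        by apply: continuous_subspaceW cfc; exact: subset_itvW.
      rewrite continuous_open_subspace; last exact: interval_open.
      by apply; rewrite inE.
    have gx : g x = fc x by rewrite gfc//; move: xab; rewrite !in_itv/= => /andP[/ltW -> ->].
    rewrite /continuous_at gx; apply: cvg_trans cx; apply: near_eq_cvg.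
    near=> y; rewrite gfc// in_itv/=.
    have : y \in `]a, b[ by near: y; exact: near_in_itvoo.
    by rewrite in_itv/= => /andP[/ltW -> ->].
  (* Restricting to the closed half [a, (a + b) / 2] yields the right limit at a. *)
  - have [_ + _] : [/\ {in `]a, (a + b) / 2[, continuous fc},
        fc @ a^'+ --> fc a & fc @ ((a + b) / 2)^'- --> fc ((a + b) / 2)].
      apply/continuous_within_itvP; first by lra.
      apply: continuous_subspaceW cfc; apply: subset_itvl.
      by rewrite bnd_simp; lra.
    rewrite [in g a]/g ab; apply: cvg_trans; apply: near_eq_cvg.
    near=> y; rewrite gfc// in_itv/=; apply/andP; split; first by near: y; exact: nbhs_right_ge.
    by near: y; exact: nbhs_right_lt.
  - rewrite [in g b]/g ltxx.
    have : fc @ b^'- --> fc a.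
      have cmax : {for f a, continuous (fun y => Num.max c y)}.
        by apply: (@continuous_max R R (cst c) id); [exact: cvg_cst|exact: cvg_id].
      exact: (cvg_comp _ _ fb cmax).
    apply: cvg_trans; apply: near_eq_cvg.
    near=> y; rewrite gfc// in_itv/=; apply/andP; split; last by near: y; exact: nbhs_left_lt.
    by near: y; exact: nbhs_left_ge.
have [M _ hM] := EVT_max (ltW ab) cg.
exists c, (g M), g; split => //.
  move=> u uab; rewrite hM// andbT /g.
  by case: ifP; rewrite /fc le_max lexx.
move=> phi cphi.
have mD (h : R -> R) : {within `[a, b[, continuous h} ->
    measurable_fun `[a, b[ (EFin \o (fun u => h u * phi u)).
  move=> ch; apply/measurable_EFinP/measurable_funM.
    exact: subspace_continuous_measurable_fun.
  by apply: measurable_funTS; exact: continuous_measurable_fun.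
have cgo : {within `[a, b[, continuous g}.
  by apply: continuous_subspaceW cg; apply: subset_itvl; rewrite bnd_simp.
rewrite /Rintegral -!integral_itv_bndo_bndc; [|exact: mD|exact: mD].
congr fine; apply: ae_eq_integral => //; [exact: mD|exact: mD|].
case: caef => N [mN N0 hN]; exists N; split => //.
move=> u /= /not_implyP[Du fgu]; apply: hN => /= /(_ Du) cfu.
by apply: fgu; rewrite gfc// /fc max_r.
Unshelve. all: by end_near. Qed.

Lemma continuous_cos_lin (R : realType) (k : R) : continuous (fun u : R => cos (k * u)).
Proof.
move=> x; apply: continuous_comp; last exact: continuous_cos.
exact: mulrl_continuous.
Qed.

Lemma integral_cos_period (R : realType) (h : int) :
  \int[lebesgue_measure]_(u in `[- 2^-1, 2^-1]) cos (2 * pi * h%:~R * u)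
  = (h == 0)%:R :> R.
Proof.
have half : - 2^-1 < 2^-1 :> R by lra.
case: eqVneq => [->|h0].
  under eq_Rintegral do rewrite mulr0 mul0r cos0.
  rewrite Rintegral_cst//= lebesgue_measure_itv/= lte_fin half.
  by rewrite -EFinB/= mul1r; lra.
set k := 2 * pi * h%:~R.
have k0 : k != 0 by rewrite !mulf_neq0// ?intr_eq0// gt_eqF// pi_gt0.
(* F is a primitive of the cosine, with F (1/2) = F (-1/2) as sin (pi h) = 0. *)
pose F u := k^-1 * sin (k * u).
have dF (u : R) : is_derive u 1 F (cos (k * u)).
  rewrite /F; apply: is_derive_eq; rewrite /GRing.scale/= mulr1.
  by rewrite mulrCA mulVf// mulr1.
have cF : continuous F.
  by move=> x; apply: differentiable_continuous; apply/derivable1_diffP; case: (dF x).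
rewrite /Rintegral (@continuous_FTC2 _ _ F)//.
- rewrite -EFinB/= /F -mulrBr mulrN sinN opprK /k.
  have -> : 2 * pi * h%:~R * 2^-1 = pi * h%:~R :> R by field.
  have -> : sin (pi * h%:~R) = 0 :> R.
    have sn m : sin (pi * m%:R) = 0 :> R.
      by elim: m => [|m IH]; rewrite ?mulr0 ?sin0// -natr1 mulrDr mulr1 sinDpi IH oppr0.
    by case: h {h0 k k0 F dF cF} => m; rewrite ?NegzE ?rmorphN ?mulrN ?sinN/= sn ?oppr0.
  by rewrite addr0 mulr0.
- by apply: continuous_subspaceT; exact: continuous_cos_lin.
- split => [x _| |]; first by case: (dF x).
  + by apply: cvg_at_right_filter; exact: cF.
  + by apply: cvg_at_left_filter; exact: cF.
- by move=> x _; rewrite derive1E; apply: derive_val.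
Qed.

(** This is | sum_i v_i exp (I i t) | ^ 2, written with real functions. *)
Lemma trig_quad_sum_of_squares (R : realType) n (v : 'cV[R]_n) (t : R) :
  \sum_i \sum_j v i 0 * v j 0 * cos ((j%:R - i%:R) * t)
  = (\sum_i v i 0 * cos (i%:R * t)) ^+ 2 + (\sum_i v i 0 * sin (i%:R * t)) ^+ 2.
Proof.
rewrite !expr2 !mulr_suml -big_split/=; apply: eq_bigr => i _.
rewrite !mulr_sumr -big_split/=; apply: eq_bigr => j _.
rewrite mulrBl cosB; ring.
Qed.

Lemma quad_formE (R : realType) n (S : 'M[R]_n) (v : 'cV[R]_n) :
  (v^T *m S *m v) 0 0 = \sum_i \sum_j v i 0 * v j 0 * S i j.
Proof.
rewrite -mulmxA mxE; apply: eq_bigr => i _.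
rewrite !mxE mulr_sumr; apply: eq_bigr => j _; ring.
Qed.

Lemma Rintegral_lincomb d (T : measurableType d) (R : realType)
    (mu : {measure set T -> \bar R}) (D : set T) (I : Type) (s : seq I)
    (a : I -> R) (F : I -> T -> R) :
  measurable D -> (forall i, mu.-integrable D (EFin \o F i)) ->
  \int[mu]_(x in D) (\sum_(i <- s) a i * F i x)
  = \sum_(i <- s) a i * \int[mu]_(x in D) F i x.
Proof.
move=> mD iF.
have iaF i : mu.-integrable D (EFin \o (fun x => a i * F i x)).
  exact: (integrableZl mD (a i) (iF i)).
have isum r : mu.-integrable D (EFin \o (fun x => \sum_(i <- r) a i * F i x)).
  rewrite (_ : _ \o _ = fun x => (\sum_(i <- r) (a i * F i x)%:E)%E).
    by apply: (integrable_sum mD) => i _; exact: iaF.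
  by apply/funext => x /=; rewrite sumEFin.
elim: s => [|i s IH].
  under eq_Rintegral do rewrite big_nil.
  by rewrite big_nil Rintegral_cst// mul0r.
under eq_Rintegral do rewrite big_cons.
by rewrite RintegralD// IH big_cons RintegralZl.
Qed.

(** By linearity, the quadratic form is the integral of g T with T the
    squared modulus of the trigonometric polynomial with coefficients v.  As T is
    nonnegative, g may be replaced by its bounds, and T integrates to |v| ^ 2 by
    orthogonality. *)
Lemma toeplitz_bounds (R : realType) (g : R -> R) (c M : R) n (S : 'M[R]_n) (v : 'cV[R]_n) :
  {within `[- 2^-1, 2^-1], continuous g} ->
  (forall u, u \in `[- 2^-1, 2^-1] -> c <= g u <= M) ->
  (forall i j, S i j =
    \int[lebesgue_measure]_(u in `[- 2^-1, 2^-1])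
      (g u * cos (2 * pi * (Posz j - Posz i)%:~R * u))) ->
  c * (\sum_i v i 0 ^+ 2) <= (v^T *m S *m v) 0 0 <= M * (\sum_i v i 0 ^+ 2).
Proof.
move=> cg gcM hS.
pose D : set R := `[- 2^-1, 2^-1]%classic.
have mD : measurable (D : set (measurableTypeR R)) by exact: measurable_itv.
pose e (i j : 'I_n) (u : R) := cos (2 * pi * (Posz j - Posz i)%:~R * u).
pose T (u : R) := \sum_i \sum_j v i 0 * v j 0 * e i j u.
have ce i j : continuous (e i j) by exact: continuous_cos_lin.
have cT : continuous T.
  apply: continuous_big => [|i _]; first exact: add_continuous.
  apply: continuous_big => [|j _]; first exact: add_continuous.
  by move=> x; apply: cvgM; [exact: cvg_cst|exact: ce].
have T0 u : 0 <= T u.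
  rewrite (_ : T u = \sum_i \sum_j v i 0 * v j 0 * cos ((j%:R - i%:R) * (2 * pi * u))).
    by rewrite trig_quad_sum_of_squares addr_ge0// sqr_ge0.
  apply: eq_bigr => i _; apply: eq_bigr => j _; congr (_ * cos _).
  by rewrite rmorphB/=; ring.
have iD (h : R -> R) : {within D, continuous h} ->
    lebesgue_measure.-integrable D (EFin \o h).
  by apply: continuous_compact_integrable; exact: segment_compact.
have chM (h p : R -> R) : {within D, continuous h} -> continuous p ->
    {within D, continuous (fun u => h u * p u)}.
  by move=> ch cp x; apply: cvgM; [exact: ch|exact: (continuous_subspaceT cp)].
have key (h : R -> R) : {within D, continuous h} ->
    \int[lebesgue_measure]_(u in D) (h u * T u) =
    \sum_i \sum_j v i 0 * v j 0 * \int[lebesgue_measure]_(u in D) (h u * e i j u).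
  move=> ch; rewrite pair_bigA/=.
  have iF (p : 'I_n * 'I_n) :
      lebesgue_measure.-integrable D (EFin \o (fun u => h u * e p.1 p.2 u)).
    by apply: iD; exact: chM.
  rewrite -(Rintegral_lincomb (mu := lebesgue_measure) _ (fun p => v p.1 0 * v p.2 0) mD iF).
  apply: eq_Rintegral => u _; rewrite /T pair_bigA mulr_sumr.
  by apply: eq_bigr => p _; rewrite mulrCA.
(* Orthogonality: only the diagonal terms survive. *)
have cst_quad (k : R) : \int[lebesgue_measure]_(u in D) (k * T u) = k * (\sum_i v i 0 ^+ 2).
  rewrite (key (cst k))/=; last by apply: continuous_subspaceT => ?; exact: cvg_cst.
  rewrite mulr_sumr; apply: eq_bigr => i _.
  rewrite (bigD1 i)//= big1 ?addr0; last first.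
    move=> j ji; rewrite /= RintegralZl//; last by apply: iD; exact: continuous_subspaceT.
    rewrite integral_cos_period subr_eq0 eqz_nat.
    by rewrite (_ : (j == i :> nat) = false) ?mulr0//; exact: negbTE ji.
  rewrite /= RintegralZl//; last by apply: iD; exact: continuous_subspaceT.
  by rewrite integral_cos_period subrr eqxx mulr1 mulrC expr2.
have -> : (v^T *m S *m v) 0 0 = \int[lebesgue_measure]_(u in D) (g u * T u).
  rewrite key// quad_formE; apply: eq_bigr => i _; apply: eq_bigr => j _.
  by rewrite hS.
rewrite -!cst_quad; apply/andP; split; apply: le_Rintegral => //=.
all: try (by apply: iD; apply: chM => //; apply: continuous_subspaceT => ?; exact: cvg_cst).
- by move=> u /= uD; have /andP[? _] := gcM _ uD; rewrite ler_wpM2r.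
- by move=> u /= uD; have /andP[_ ?] := gcM _ uD; rewrite ler_wpM2r.
Qed.

Lemma covariance_spectral_bounds (R : realType) (f : R -> R) :
  {within `[- 2^-1, 2^-1[, continuous f} ->
  f x @[x --> 2^-1^'-] --> f (- 2^-1) ->
  (0 < ess_inf
     (mrestr lebesgue_measure (measurable_itv `[- 2^-1 : R, 2^-1[))%R
     (EFin \o f))%E ->
  exists c M : R, [/\ 0 < c, 0 < M & forall n (S : 'M[R]_n),
    map_mx (real_complex R) S = \matrix_(i, j) fourier_coef f (Posz j - Posz i) ->
    forall v : 'cV[R]_n,
    c * (\sum_i v i 0 ^+ 2) <= (v^T *m S *m v) 0 0 <= M * (\sum_i v i 0 ^+ 2)].
Proof.
move=> cf pf posf.
have half : - 2^-1 < 2^-1 :> R by lra.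
have [c [M [g [c0 cg gcM gf]]]] := spectral_regularize half cf pf posf.
exists c, M; split => //.
  have /gcM/andP[] : - 2^-1 \in `[- 2^-1 : R, 2^-1] by rewrite in_itv/= lexx ltW.
  by move=> h1 h2; exact: lt_le_trans c0 (le_trans h1 h2).
move=> n S hS v; apply: toeplitz_bounds cg gcM _ => i j.
rewrite -gf; last exact: continuous_cos_lin.
move/matrixP: hS => /(_ i j); rewrite !mxE => /(congr1 (@complex.Re R)).
by [].
Qed.

(** * Indicators of intervals on the grid i/n *)

(** Coordinate i stands for the point i + 1, so the points of [p, q) are those
    with p <= i + 1 < q. *)
Definition block {R : realType} (n p q : nat) : 'cV[R]_n :=
  \col_(i < n) ((p <= i.+1 < q)%N)%:R.

(** For a natural number i, n a <= i holds exactly when ceil (n a) <= i, hence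
    the points i / n of [a, b) are given by p = ceil (n a) and q = ceil (n b). *)
Lemma ind_block (R : realType) n (lam : R) (I : set R) :
  (0 < n)%N -> 0 < lam -> intervals lam I ->
  exists p q : nat, [/\ ind n I = block n p q, (q <= n)%N &
    (p + Num.truncn (n%:R * lam) <= q <= p + Num.truncn (n%:R * lam) + 1)%N].
Proof.
move=> n0 lam0 [a [b [a0 ab b1 bal ->]]].
have nR : 0 < n%:R :> R by rewrite ltr0n.
have ceil_nat (x : R) : 0 <= x -> exists k : nat,
    [/\ k%:R - 1 < x, x <= k%:R & forall i : nat, (k <= i)%N = (x <= i%:R)].
  move=> x0; have c0 : 0 <= Num.ceil x by rewrite ceil_ge0; lra.
  exists `|Num.ceil x|%N; have E : (`|Num.ceil x|%N)%:R = (Num.ceil x)%:~R :> R.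
    by rewrite -[in RHS](gez0_abs c0).
  have := ceil_itv x; rewrite intrB -E => /andP[h1 h2].
  split => // i; rewrite -[RHS](ceil_le_int x i) -lez_nat.
  by rewrite gez0_abs.
have na0 : 0 <= n%:R * a by rewrite mulr_ge0.
have nb0 : 0 <= n%:R * b by rewrite mulr_ge0// (le_trans a0)// ltW.
have [p [p1 p2 pE]] := ceil_nat _ na0.
have [q [q1 q2 qE]] := ceil_nat _ nb0.
have /andP[m1 m2] := truncn_itv (mulr_ge0 (ltW nR) (ltW lam0)).
set m := Num.truncn _ in m1 m2 *.
exists p, q; split.
- apply/matrixP => i j; rewrite !mxE indicE pE ltnNge qE -ltNge.
  by rewrite mem_setE in_itv/= ler_pdivlMr// ltr_pdivrMr// ![_ * n%:R]mulrC.
- by rewrite qE ler_piMr// ltW.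
- rewrite -natr1 in m2.
  have E : n%:R * b = n%:R * a + n%:R * lam by rewrite -bal; ring.
  apply/andP; split.
    rewrite -ltnS -(ltr_nat R) -natr1 natrD; lra.
  rewrite -ltnS -(ltr_nat R) -natr1 !natrD; lra.
Qed.

(** The predecessors account for the point 0, which lies in [p, q) when
    p = 0 but is not a coordinate. *)
Lemma sum_between n p q : (\sum_(i < n) (p <= i.+1 < q))%N = (minn n q.-1 - p.-1)%N.
Proof.
elim: n => [|n IH]; first by rewrite big_ord0 min0n.
rewrite big_ord_recr/= IH; case: (leqP p n.+1); case: (ltnP n.+1 q) => /= *; lia.
Qed.

Lemma block_sqnorm (R : realType) n p q :
  \sum_i (block n p q : 'cV[R]_n) i 0 ^+ 2 = (minn n q.-1 - p.-1)%:R.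
Proof.
rewrite -sum_between natr_sum; apply: eq_bigr => i _; rewrite mxE.
by case: (_ && _); rewrite ?expr1n ?expr0n.
Qed.

Lemma block_diff_sqnorm (R : realType) n p q p' q' : (p' <= p)%N -> (q' <= q)%N ->
  \sum_i (block n p q - block n p' q' : 'cV[R]_n) i 0 ^+ 2 <= (p - p' + (q - q'))%:R.
Proof.
move=> hp hq.
apply: (@le_trans _ _ (\sum_(i < n) ((p' <= i.+1 < p) + (q' <= i.+1 < q))%:R)).
  apply: ler_sum => i _; rewrite !mxE.
  case: (leqP p' i.+1); case: (leqP p i.+1); case: (ltnP i.+1 q); case: (ltnP i.+1 q') => /= *;
   rewrite ?subrr ?subr0 ?sub0r ?sqrrN ?expr1n ?expr0n ?ler0n ?lexx//; try lia; try lra.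
rewrite -natr_sum ler_nat big_split/= !sum_between; lia.
Qed.

(** * The scan statistic at finite n *)

Lemma scan_testP_gt (R : realType) n (S : 'M[R]_n) (lam c : R) (y : n.-tuple R) :
  scan_test S lam c y -> exists2 I, intervals lam I /\ ind n I != 0 &
    c < `| ((ind n I)^T *m vec y) 0 0 | / Num.sqrt (sigma S I).
Proof.
rewrite /scan_test /scan_stat => /ereal_sup_gt[_ [I hI <-]].
by rewrite lte_fin => h; exists I.
Qed.

Lemma scan_test_of_gt (R : realType) n (S : 'M[R]_n) (lam c : R) (y : n.-tuple R) I :
  intervals lam I -> ind n I != 0 ->
    c < `| ((ind n I)^T *m vec y) 0 0 | / Num.sqrt (sigma S I) -> scan_test S lam c y.
Proof.
move=> hI I0 cI; rewrite /scan_test /scan_stat; apply: (@lt_le_trans _ _ (_%:E)).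
  by rewrite lte_fin; exact: cI.
by apply: ereal_sup_ubound; exists I.
Qed.

(** There are uncountably many intervals but only countably many
    indicators, so the rejection region is a countable union of complements of
    slabs. *)
Lemma measurable_scan_test (R : realType) n (S : 'M[R]_n) (lam c : R) :
  (0 < n)%N -> 0 < lam -> measurable [set y : n.-tuple R | scan_test S lam c y = true].
Proof.
move=> n0 lam0.
pose ok p q := exists2 I, intervals lam I /\ ind n I != 0 & ind n I = block n p q :> 'cV[R]_n.
pose A p q := [set y : n.-tuple R | ok p q /\
   c < `| ((block n p q)^T *m vec y) 0 0 | / Num.sqrt (qform S (block n p q) (block n p q))].
rewrite (_ : [set _ | _] = \bigcup_p \bigcup_q A p q).
  apply: bigcupT_measurable => p; apply: bigcupT_measurable => q.
  rewrite /A; have [okpq|nok] := pselect (ok p q).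
    rewrite (_ : [set _ | _] = [set y : n.-tuple R |
      c < `|((block n p q)^T *m vec y) 0 0| / Num.sqrt (qform S (block n p q) (block n p q))]).
      exact: measurable_absdot_gt.
    by apply/seteqP; split => y //= [].
  rewrite (_ : [set _ | _] = set0)//.
  by apply/seteqP; split => y //= [].
apply/seteqP; split => y /=.
  move/scan_testP_gt => [I [hI I0] cI].
  have [p [q [E _ _]]] := ind_block n0 lam0 hI.
  exists p => //; exists q => //; split; first by exists I.
  by rewrite -E.
move=> [p _ [q _ [[I [hI I0] E]]]]; rewrite -E => h.
exact: scan_test_of_gt h.
Qed.

(** At fixed n there are at most (n + 1) ^ 2 indicators, so that a
    plain union bound suffices when no control of the threshold is required. *)
Lemma exists_level_threshold (R : realType) (alpha : R) n (S : 'M[R]_n) (lam : R)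
    (P : probability (n.-tuple R) R) :
  (0 < n)%N -> 0 < lam -> 0 < alpha -> is_gaussian 0 S P -> is_covariance S ->
  exists c : R, (P [set y | scan_test S lam c y = true] <= alpha%:E)%E.
Proof.
move=> n0 lam0 al0 gP cS.
pose K : R := #|{: 'I_n.+1 * 'I_n.+1}|%:R.
pose c := 1 + 4 * K / alpha.
have K0 : 0 <= K by rewrite ler0n.
have c1 : 1 <= c by rewrite lerDl divr_ge0 ?mulr_ge0// ltW.
exists c.
apply: (le_trans (gaussian_union_bound (I := ('I_n.+1 * 'I_n.+1)%type)
   (a := fun i => normalize S (block n i.1 i.2)) (w := fun=> 1) (t := fun=> c) gP cS _ _ _ _ _)).
- by move=> i; exact: normalize_var.
- by [].
- by move=> _; lra.
- exact: measurable_scan_test.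
- move=> y /= /scan_testP_gt[I [hI _]] cI.
  have [p [q [E qn pq]]] := ind_block n0 lam0 hI.
  have pn : (p < n.+1)%N by move: pq qn; clear; lia.
  exists (Ordinal pn, Ordinal (qn : (q < n.+1)%N)) => /=.
  by rewrite -E -absdot_normalize ltW.
rewrite lee_fin sumr_const -[X in X <= _]mulr_natl -/K.
have -> : - c ^+ 2 / (1 *+ 2) = - (c ^+ 2 / 2) :> R by field.
rewrite expRN mulrA ler_pdivrMr ?expR_gt0//.
have := expR_ge1Dx (c ^+ 2 / 2).
have : 4 * K <= alpha * c by rewrite /c mulrDr mulrCA divff ?gt_eqF// !mulr1 lerDr ltW.
nra.
Qed.

(** The chaining step.  An interval starting at p is compared with the grid
    interval starting at r (p / r) and having the minimal number m of points; s is the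
    level allowed on the grid and tau the one allowed for the differences, whose
    variance is at most V. *)
Lemma scan_null_bound (R : realType) n (S : 'M[R]_n) (P : probability (n.-tuple R) R)
    (lam c0 M V s tau : R) (r : nat) :
  (0 < n)%N -> 0 < lam -> is_gaussian 0 S P -> is_covariance S ->
  0 < c0 ->
  (forall v : 'cV[R]_n, c0 * (\sum_i v i 0 ^+ 2) <= qform S v v <= M * (\sum_i v i 0 ^+ 2)) ->
  0 <= M -> (1 < Num.truncn (n%:R * lam))%N -> (0 < r)%N -> 0 < s -> 0 < tau -> 0 < V ->
  M * (2 * r)%:R <= V * (c0 * ((Num.truncn (n%:R * lam)).-1)%:R) ->
  (P [set y | scan_test S lam (s + tau) y = true] <=
    ((n %/ r).+1%:R * (2 * expR (- s ^+ 2 / 2)) +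
     (2 * n.+1)%:R * (2 * expR (- tau ^+ 2 / (V *+ 2))))%:E)%E.
Proof.
set m := Num.truncn _ => n0 lam0 gP cS c00 specS M0 m1 r0 s0 tau0 V0 hV.
pose J : finType := ('I_(n %/ r).+1 + 'I_n.+1 * bool)%type.
pose u (p : nat) := block n (r * p) (r * p + m) : 'cV[R]_n.
(* The zero vector stands for pairs (p, d) whose interval leaves [0, n]; their
   variance is then trivially at most V. *)
pose a (j : J) : 'cV[R]_n := match j with
  | inl k => normalize S (u k)
  | inr (p, d) => if (p + m + d <= n)%N then
       normalize S (block n p (p + m + d)) - normalize S (u (p %/ r)%N) else 0
  end.
pose w (j : J) : R := if j is inl _ then 1 else V.
pose t (j : J) : R := if j is inl _ then s else tau.
have form_lb p q : (q <= n)%N -> (p + m <= q)%N ->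
    c0 * m.-1%:R <= qform S (block n p q) (block n p q).
  move=> qn pq; have /andP[+ _] := specS (block n p q).
  apply: le_trans; rewrite ler_pM2l// block_sqnorm ler_nat; move: qn pq; clear; lia.
have cm0 : 0 < c0 * m.-1%:R by rewrite mulr_gt0// ltr0n -subn1 subn_gt0.
have rdiv p : (r * (p %/ r) <= p)%N /\ (p < r * (p %/ r) + r)%N.
  have := divn_eq p r; have := ltn_pmod p r0; clear.
  by rewrite [(p %/ r * r)%N]mulnC; move: (r * _)%N => z; lia.
apply: (le_trans (gaussian_union_bound (a := a) (w := w) (t := t) gP cS _ _ _ _ _)).
- case=> [k|[p d]]; first exact: normalize_var.
  rewrite /a /w; case: ifP => pn; last by rewrite trmx0 !mul0mx mxE ltW.
  have [r1 r2] := rdiv p.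
  have wlb := form_lb p (p + m + d)%N pn (leq_addr _ _).
  have kmn : (r * (p %/ r) + m <= n)%N.
    by apply: leq_trans pn; rewrite -addnA leq_add// leq_addr.
  have ulb := form_lb (r * (p %/ r))%N (r * (p %/ r) + m)%N kmn (leqnn _).
  have w0 := lt_le_trans cm0 wlb; have u0 := lt_le_trans cm0 ulb.
  apply: le_trans (normalized_diff_variance cS w0 u0) _.
  rewrite ler_pdivrMr ?mulr_gt0 ?sqrtr_gt0//.
  have /andP[_ h] := specS (block n p (p + m + d) - block n (r * (p %/ r)) (r * (p %/ r) + m)).
  apply: le_trans h _; apply: (@le_trans _ _ (M * (2 * r)%:R)).
    have pm : (r * (p %/ r) + m <= p + m + d)%N by rewrite -addnA leq_add// leq_addr.
    rewrite ler_wpM2l// (le_trans (block_diff_sqnorm _ _ r1 pm))// ler_nat.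
    move: r1 r2; clear; move: (r * _)%N => z; case: d => /=; lia.
  apply: le_trans hV _; rewrite ler_wpM2l ?(ltW V0)//.
  rewrite -[leLHS](sqr_sqrtr (ltW cm0)) expr2.
  by apply: ler_pM; rewrite ?sqrtr_ge0// ler_sqrt// ltW.
- by case.
- by case.
- exact: measurable_scan_test.
- move=> y /= /scan_testP_gt[I [hI _]] cI.
  have [p [q [E qn pq]]] := ind_block n0 lam0 hI.
  have [r1 r2] := rdiv p.
  (* An interval of length lam has m or m + 1 points. *)
  have [d qE] : exists d : bool, q = (p + m + d)%N.
    by exists (p + m < q)%N; move: pq; rewrite -/m; clear; case: ltnP => /=; lia.
  have pn : (p < n.+1)%N by move: pq qn; clear; lia.
  have kn : (p %/ r < (n %/ r).+1)%N by rewrite ltnS leq_div2r.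
  (* Either the grid neighbour is already large, or the difference is. *)
  have [big|small] := leP s `|((normalize S (u (p %/ r)%N))^T *m vec y) 0 0|.
    by exists (inl (Ordinal kn)).
  exists (inr (Ordinal pn, d)); rewrite /a /t/= -qE qn.
  have subE (x z : 'cV[R]_n) : ((x - z)^T *m vec y) 0 0
      = (x^T *m vec y) 0 0 - (z^T *m vec y) 0 0.
    have -> : (x - z)^T = x^T - z^T by rewrite linearB.
    by rewrite mulmxBl mxE [X in _ + X]mxE.
  rewrite subE.
  move: cI; rewrite /sigma -/(qform S (ind n I) (ind n I)) absdot_normalize E => cI.
  apply: le_trans (lerB_dist _ _).
  lra.
rewrite lee_fin big_sumType/= !sumr_const lerD//.
  by rewrite card_ord [leRHS]mulr_natl.
by rewrite card_prod card_ord card_bool [leRHS]mulr_natl mulnC.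
Qed.

(** If the test accepts, the normalized statistic of the true interval is
    at most c in modulus, hence at distance at least t from its mean. *)
Lemma scan_power_bound (R : realType) n (S : 'M[R]_n) (P : probability (n.-tuple R) R)
    (lam delta c t : R) (I : set R) :
  (0 < n)%N -> 0 < lam -> is_gaussian (delta *: ind n I) S P -> is_covariance S ->
  intervals lam I -> ind n I != 0 -> 0 < t ->
  c + t <= `|delta| * ((\sum_i (ind n I) i 0 ^+ 2) / Num.sqrt (sigma S I)) ->
  (P [set y | scan_test S lam c y = false] <= (2 * expR (- t ^+ 2 / 2))%:E)%E.
Proof.
move=> n0 lam0 gP cS hI I0 t0 hct.
pose a := normalize S (ind n I).
have mscan : measurable [set y : n.-tuple R | scan_test S lam c y = false].
  rewrite (_ : [set _ | _] = ~` [set y | scan_test S lam c y = true]).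
    by apply: measurableC; exact: measurable_scan_test.
  by apply/seteqP; split => y /=; case: scan_test.
apply: (@le_trans _ _ (P [set y | (t <= `|(a^T *m vec y) 0 0 -
    (a^T *m (delta *: ind n I)) 0 0|)%R])); last first.
  have := gaussian_tail (a := a) gP cS (normalize_var _ cS) ltr01 t0.
  by rewrite (_ : 1 *+ 2 = 2).
apply: le_measure; rewrite ?inE//; first exact: measurable_absdot_ge.
move=> y /= hy.
have ac : `|(a^T *m vec y) 0 0| <= c.
  rewrite leNgt -absdot_normalize; apply/negP => h.
  by move: hy; rewrite (scan_test_of_gt hI I0 h).
have E : `|(a^T *m (delta *: ind n I)) 0 0|
    = `|delta| * ((\sum_i (ind n I) i 0 ^+ 2) / Num.sqrt (sigma S I)).
  rewrite normalize_dot -scalemxAr mxE -mulrA normrM; congr (_ * _).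
  have -> : ((ind n I)^T *m ind n I) 0 0 = \sum_i (ind n I) i 0 ^+ 2 :> R.
    by rewrite mxE; apply: eq_bigr => i _; rewrite mxE expr2.
  by rewrite ger0_norm// divr_ge0 ?sqrtr_ge0// sumr_ge0// => i _; exact: sqr_ge0.
rewrite distrC; apply: le_trans (lerB_dist _ _); rewrite E; lra.
Qed.

(** * The explicit threshold *)

(** A crude form of the Gaussian decay, enough to choose explicit
    constants: exp (x ^ 2 / 2) is at least x / 2. *)
Lemma expR_half_sqr_le (R : realType) (a x : R) : 0 < a -> 1 <= x -> 2 / a <= x ->
  expR (- x ^+ 2 / 2) <= a.
Proof.
move=> a0 x1; rewrite ler_pdivrMr// => xa.
rewrite mulNr expRN -[leRHS]invrK lef_pV2 ?posrE ?expR_gt0 ?invr_gt0//.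
apply: le_trans (expR_ge1Dx _).
have : a^-1 <= x / 2 by rewrite -[leLHS]mul1r ler_pdivrMr//; lra.
have : x <= x ^+ 2 by rewrite expr2 ler_peMl//; lra.
lra.
Qed.

(** The cross term 2 sqrt 2 a b is at least b ^ 2; this supplies the second b ^ 2,
    needed to pay for the logarithmic refinement of the grid. *)
Lemma threshold_sqr (R : realType) (a b K : R) : 0 <= b -> b <= a -> 0 <= K ->
  2 * a ^+ 2 + 2 * b ^+ 2 + K ^+ 2 <= (Num.sqrt 2 * a + b + K) ^+ 2.
Proof.
move=> b0 ba K0; set q := Num.sqrt 2.
have q2 : q ^+ 2 = 2 by rewrite sqr_sqrtr.
have q1 : 1 <= q by rewrite -sqrtr1 ler_sqrt//; lra.
have a0 : 0 <= a by exact: le_trans ba.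
have -> : (q * a + b + K) ^+ 2 =
   q ^+ 2 * a ^+ 2 + b ^+ 2 + K ^+ 2 + 2 * (q * a) * b + 2 * (q * a) * K + 2 * b * K.
  by ring.
rewrite q2.
have qa : a <= q * a by rewrite ler_peMl.
have h1 : b ^+ 2 <= (q * a) * b by rewrite expr2 ler_wpM2r//; lra.
have h2 : 0 <= (q * a) * K by rewrite mulr_ge0//; lra.
have h3 : 0 <= b * K by rewrite mulr_ge0.
have h4 : 0 <= b ^+ 2 by exact: sqr_ge0.
nra.
Qed.

Definition scan_threshold {R : realType} (lam : R) (n : nat) (K : R) : R :=
  Num.sqrt 2 * Num.sqrt (- ln lam) + Num.sqrt (ln (ln n%:R)) + K.

(** Here r is m / ln n rounded down.  The constant 64 / alpha makes the grid
    contribute at most alpha / 2, and tau = 4 sqrt (M / c0) makes each difference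
    contribute 2 / n ^ 2. *)
Lemma scan_size (R : realType) n (S : 'M[R]_n) (P : probability (n.-tuple R) R)
    (alpha lam c0 M : R) :
  0 < alpha < 1 -> (0 < n)%N -> 0 < lam -> is_gaussian 0 S P -> is_covariance S ->
  0 < c0 -> 0 < M ->
  (forall v : 'cV[R]_n, c0 * (\sum_i v i 0 ^+ 2) <= qform S v v <= M * (\sum_i v i 0 ^+ 2)) ->
  1 <= ln (ln n%:R) :> R -> lam * ln n%:R <= 1 -> 3 * ln n%:R <= n%:R * lam ->
  lam < 1 -> 16 / alpha <= n%:R ->
  (P [set y | scan_test S lam
        (scan_threshold lam n (64 / alpha + 4 * Num.sqrt (M / c0))) y = true]
     <= alpha%:E)%E.
Proof.
move=> /andP[al0 al1] n0 lam0 gP cS c00 M0 spec ll1 lamln nlam lam1 nal.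
have nR : 0 < n%:R :> R by rewrite ltr0n.
set l := ln n%:R in ll1 lamln nlam.
have l1 : 1 < l.
  rewrite ltNge; apply/negP => /ln_le0; lra.
have l0 : 0 < l by lra.
pose m := Num.truncn (n%:R * lam).
have nlam0 : 0 <= n%:R * lam by rewrite mulr_ge0// ltW.
have /andP[m1 m2] := truncn_itv nlam0; rewrite -/m -natr1 in m1 m2.
have mn : (m <= n)%N.
  by rewrite -(ler_nat R) (le_trans m1)// ler_piMr// ltW.
have m2' : (1 < m)%N by rewrite -(ltr_nat R); lra.
pose r := Num.truncn (m%:R / l).
have ml0 : 0 <= m%:R / l by rewrite divr_ge0// ltW.
have /andP[r1 r2] := truncn_itv ml0; rewrite -/r -natr1 in r1 r2.
have ml1 : 1 <= m%:R / l by rewrite ler_pdivlMr//; lra.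
have r0 : (0 < r)%N by rewrite -(ltr_nat R); lra.
have rR : 1 <= r%:R :> R by rewrite ler1n.
have rn : (r <= n)%N.
  apply: leq_trans mn; rewrite -(ler_nat R) (le_trans r1)// ler_pdivrMr//.
  by rewrite ler_peMr// ltW.
pose L := - ln lam.
have L0 : ln l <= L.
  rewrite /L -lnV ?posrE// ler_ln ?posrE ?invr_gt0//.
  by rewrite -[leRHS]mul1r ler_pdivlMr// mulrC.
pose K := 64 / alpha; pose tau := 4 * Num.sqrt (M / c0).
pose s := Num.sqrt 2 * Num.sqrt L + Num.sqrt (ln l) + K.
have Mc : 0 < M / c0 by rewrite divr_gt0.
have tau0 : 0 < tau by rewrite mulr_gt0// sqrtr_gt0.
have tau2 : tau ^+ 2 = 16 * (M / c0) by rewrite exprMn sqr_sqrtr ?ltW//; ring.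
have K1 : 1 <= K by rewrite ler_pdivlMr//; lra.
have sE : s ^+ 2 >= 2 * L + 2 * ln l + K ^+ 2.
  have := @threshold_sqr R (Num.sqrt L) (Num.sqrt (ln l)) K (sqrtr_ge0 _).
  have ll0 : 0 <= ln l by exact: le_trans ll1.
  have LL0 : 0 <= L by exact: le_trans L0.
  rewrite ler_sqrt// !sqr_sqrtr//; apply => //; exact: le_trans K1.
have s0 : 0 < s.
  by rewrite ltr_wpDl ?addr_ge0 ?mulr_ge0 ?sqrtr_ge0// (lt_le_trans ltr01).
pose V := 4 * (M / c0) / l.
have V0 : 0 < V by rewrite divr_gt0// mulr_gt0.
have hV : M * (2 * r)%:R <= V * (c0 * m.-1%:R).
  have -> : V * (c0 * m.-1%:R) = M * (4 * m.-1%:R / l) by rewrite /V; field; rewrite !gt_eqF.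
  rewrite ler_wpM2l ?(ltW M0)// natrM.
  have : m%:R = m.-1%:R + 1 :> R by rewrite natr1 prednK// ltnW.
  have : 1 <= m.-1%:R :> R by rewrite ler1n -subn1 subn_gt0.
  have : r%:R * l <= m%:R by rewrite -ler_pdivlMr.
  rewrite ler_pdivlMr//; move: (m.-1%:R : R) => z; clear; lra.
have := scan_null_bound n0 lam0 gP cS c00 spec (ltW M0) m2' r0 s0 tau0 V0 hV.
rewrite /scan_threshold addrA -/L -/l -/K -/s -/tau => hP.
apply: le_trans hP _; rewrite lee_fin.
(* r >= m / (2 ln n) and m >= n lam / 2. *)
have grid : (n %/ r).+1%:R <= 8 * (l / lam).
  have h1 : (n %/ r).+1%:R * r%:R <= 2 * n%:R :> R.
    rewrite -!natrM ler_nat; have := divn_eq n r; have := ltn_pmod n r0.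
    have : (r <= n %/ r * r)%N by rewrite leq_pmull// divn_gt0.
    by rewrite mulSn; clear; lia.
  have h2 : m%:R <= 2 * r%:R * l by rewrite -ler_pdivrMr//; lra.
  have m2R : 2 <= m%:R :> R by rewrite ler_nat.
  have h3 : n%:R * lam <= 2 * m%:R by lra.
  have h4 : n%:R * lam <= 4 * r%:R * l by lra.
  rewrite mulrA ler_pdivlMr//.
  rewrite -(ler_pM2r (_ : 0 < r%:R :> R)) ?ltr0n//.
  have -> : (n %/ r).+1%:R * lam * r%:R = ((n %/ r).+1%:R * r%:R) * lam :> R by ring.
  apply: le_trans (ler_wpM2r (ltW lam0) h1) _; lra.
have es : expR (- s ^+ 2 / 2) <= (lam / l) * (alpha / 32).
  apply: (@le_trans _ _ (expR (ln lam + (- ln l + - K ^+ 2 / 2)))).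
    rewrite ler_expR; rewrite /L in sE; lra.
  rewrite !expRD expRN !lnK ?posrE// mulrA.
  rewrite ler_wpM2l ?(divr_ge0 (ltW lam0) (ltW l0))//.
  apply: expR_half_sqr_le => //; first by rewrite divr_gt0.
  by rewrite /K invf_div; lra.
(* V is of order 1 / ln n, so a constant tau gives a power of n. *)
have et : expR (- tau ^+ 2 / (V *+ 2)) = (n%:R ^+ 2)^-1.
  have -> : - tau ^+ 2 / (V *+ 2) = - (l *+ 2).
    rewrite tau2 /V; field; rewrite !gt_eqF//.
  by rewrite expRN mulr2n expRD lnK ?posrE// expr2.
have first : (n %/ r).+1%:R * (2 * expR (- s ^+ 2 / 2)) <= alpha / 2.
  apply: (@le_trans _ _ ((8 * (l / lam)) * (2 * ((lam / l) * (alpha / 32))))).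
    by apply: ler_pM => //; rewrite ?mulr_ge0 ?expR_ge0// ler_wpM2l.
  rewrite le_eqVlt; apply/orP; left; apply/eqP; field.
  by rewrite !gt_eqF.
have second : (2 * n.+1)%:R * (2 * expR (- tau ^+ 2 / (V *+ 2))) <= alpha / 2.
  rewrite et natrM -[n.+1%:R]natr1 mulrA ler_pdivrMr ?exprn_gt0//.
  have n1 : 1 <= n%:R :> R by rewrite ler1n.
  have n16 : 16 <= alpha * n%:R by rewrite mulrC -ler_pdivrMr.
  have := ler_wpM2r (ltW nR) n16.
  move: n1; clear; rewrite expr2; lra.
move: first second; clear; lra.
Qed.

(** One point may be missing from the floor of n lam: the interval [0, lam)
    contains the point 0, which is not a coordinate. *)
Lemma ind_sqnorm_ge (R : realType) n (lam : R) (I : set R) :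
  (0 < n)%N -> 0 < lam -> intervals lam I ->
  (Num.truncn (n%:R * lam)).-1%:R <= \sum_i (ind n I : 'cV[R]_n) i 0 ^+ 2.
Proof.
move=> n0 lam0 hI; have [p [q [-> qn pq]]] := ind_block n0 lam0 hI.
rewrite block_sqnorm ler_nat; move: qn pq; clear; lia.
Qed.

(** The separation condition bounds the signal below by
    (sqrt 2 + e) sqrt (- ln lam) up to the factor (m - 1) / m.  This product is at
    most m, because - ln lam <= ln n is small compared with n lam, so the factor
    costs at most 1. *)
Lemma scan_power (R : realType) n (S : 'M[R]_n) (P : 'cV[R]_n -> probability (n.-tuple R) R)
    (alpha lam c0 Delta e K : R) :
  0 < alpha < 1 -> (0 < n)%N -> 0 < lam -> (forall mu, is_gaussian mu S (P mu)) ->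
  is_covariance S -> 0 < c0 ->
  (forall v : 'cV[R]_n, c0 * (\sum_i v i 0 ^+ 2) <= qform S v v) ->
  1 <= ln (ln n%:R) :> R -> lam * ln n%:R <= 1 -> 3 * ln n%:R <= n%:R * lam ->
  0 < Delta -> `|e| <= 1 / 2 ->
  1 + K + 4 / alpha <= e * Num.sqrt (- ln lam) - Num.sqrt (ln (ln n%:R)) ->
  (Num.sqrt 2 + e) * Num.sqrt (- ln lam) <=
    Delta * inf [set (Num.floor (n%:R * lam))%:~R / Num.sqrt (sigma S I)
                | I in intervals lam] ->
  (beta_err P lam Delta (scan_test S lam (scan_threshold lam n K)) <= alpha%:E)%E.
Proof.
move=> /andP[al0 al1] n0 lam0 gP cS c00 spec ll1 lamln nlam D0 e12 hK hsep.
have nR : 0 < n%:R :> R by rewrite ltr0n.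
set l := ln n%:R in ll1 lamln nlam hK.
have l1 : 1 < l.
  rewrite ltNge; apply/negP => /ln_le0; lra.
have l0 : 0 < l by lra.
pose m := Num.truncn (n%:R * lam).
have nlam0 : 0 <= n%:R * lam by rewrite mulr_ge0// ltW.
have /andP[m1 m2] := truncn_itv nlam0; rewrite -/m -natr1 in m1 m2.
have m2' : (1 < m)%N by rewrite -(ltr_nat R); lra.
have mm : m%:R = m.-1%:R + 1 :> R by rewrite natr1 prednK// ltnW.
have mpos : 1 <= m.-1%:R :> R by rewrite ler1n -subn1 subn_gt0.
pose L := - ln lam; rewrite -/L in hK hsep.
have L1 : 1 <= L.
  apply: le_trans ll1 _; rewrite /L -lnV ?posrE// ler_ln ?posrE ?invr_gt0//.
  by rewrite -[leRHS]mul1r ler_pdivlMr// mulrC.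
have Ll : L <= l.
  rewrite /L -lnV ?posrE// ler_ln ?posrE ?invr_gt0//.
  by rewrite -[leLHS]mul1r ler_pdivrMr//; lra.
have sqL : Num.sqrt L <= L.
  rewrite -[leRHS]sqr_sqrtr; last lra.
  by rewrite expr2 ler_peMr ?sqrtr_ge0// -sqrtr1 ler_sqrt//; lra.
have q1 : 1 <= Num.sqrt 2 :> R by rewrite -[leLHS]sqrtr1 ler_sqrt//; lra.
have q2 : Num.sqrt 2 <= 3 / 2 :> R.
  have -> : 3 / 2 = Num.sqrt ((3 / 2) ^+ 2) :> R by rewrite sqrtr_sqr ger0_norm//; lra.
  by rewrite ler_sqrt; lra.
move: e12; rewrite ler_norml => /andP[e1 e2].
have sqL0 : 0 <= Num.sqrt L by exact: sqrtr_ge0.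
pose B := (Num.sqrt 2 + e) * Num.sqrt L.
have B0 : 0 <= B by rewrite mulr_ge0//; lra.
have Bm : B <= m%:R.
  apply: (@le_trans _ _ (2 * L)); last lra.
  by apply: ler_pM => //; lra.
apply: ge_ereal_sup => _ [I hI <-]; apply: ge_ereal_sup => _ [delta /= hd <-].
have cnt := ind_sqnorm_ge n0 lam0 hI; rewrite -/m in cnt.
set N := \sum_i _ in cnt.
have N0 : 0 < N by lra.
have sig0 : 0 < sigma S I.
  by apply: lt_le_trans (spec (ind n I)); rewrite mulr_gt0.
have I0 : ind n I != 0 :> 'cV[R]_n.
  apply/eqP => E; move: N0; rewrite /N E big1 ?ltxx// => i _.
  by rewrite mxE expr0n.
have t0 : 0 < 4 / alpha by rewrite divr_gt0.
have floorE : (Num.floor (n%:R * lam))%:~R = m%:R :> R.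
  rewrite /m truncn_floor nlam0 -[in LHS](gez0_abs (_ : 0 <= Num.floor _))//.
  by rewrite floor_ge0.
have infI : inf [set (Num.floor (n%:R * lam))%:~R / Num.sqrt (sigma S I)
                | I in intervals lam] <= m%:R / Num.sqrt (sigma S I).
  apply: ge_inf; last by exists I => //; rewrite floorE.
  by exists 0 => _ [J _ <-]; rewrite floorE divr_ge0 ?sqrtr_ge0.
have Bsig : B <= Delta * (m%:R / Num.sqrt (sigma S I)).
  by apply: le_trans hsep _; rewrite ler_wpM2l ?(ltW D0).
have signal : B - 1 <= `|delta| * (N / Num.sqrt (sigma S I)).
  apply: (@le_trans _ _ (Delta * (N / Num.sqrt (sigma S I)))); last first.
    by rewrite ler_wpM2r// divr_ge0 ?sqrtr_ge0// ltW.
  have sq0 : 0 < Num.sqrt (sigma S I) by rewrite sqrtr_gt0.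
  set z := (Num.sqrt (sigma S I))^-1 in Bsig *.
  have z0 : 0 < z by rewrite invr_gt0.
  apply: (@le_trans _ _ (Delta * (m.-1%:R * z))); last first.
    by rewrite ler_wpM2l ?(ltW D0)// ler_wpM2r ?(ltW z0).
  rewrite -(ler_pM2r (_ : 0 < m%:R :> R)); last lra.
  have -> : Delta * (m.-1%:R * z) * m%:R = m.-1%:R * (Delta * (m%:R * z)) by ring.
  apply: (@le_trans _ _ (m.-1%:R * B)); last by rewrite ler_wpM2l.
  by rewrite mm in Bm *; move: Bm; clear; lra.
apply: (le_trans (scan_power_bound (t := 4 / alpha) n0 lam0 (gP _) cS hI I0 t0 _)).
  apply: le_trans signal; rewrite /scan_threshold -/L -/l /B; move: hK; clear; lra.
rewrite lee_fin -ler_pdivlMl//; apply: expR_half_sqr_le.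
- by rewrite mulr_gt0.
- by rewrite ler_pdivlMr//; lra.
- by rewrite invfM invrK mulrA; lra.
Qed.

(** * The limit theorem *)

Lemma limn_esup_le_near (R : realType) (u : nat -> \bar R) (x : \bar R) :
  (\forall n \near \oo, (u n <= x)%E) -> (limn_esup u <= x)%E.
Proof.
move=> ux; apply: (@le_trans _ _ (ereal_sup [set u n | n in [set n | (u n <= x)%E]])).
  by apply: ereal_inf_lbound; exists [set n | (u n <= x)%E].
by apply: ge_ereal_sup => _ [n /= h <-].
Qed.

Theorem lemma5p7 (R : realType) (alpha : R) (halpha : 0 < alpha < 1)
  (lambda : nat -> R)
  (hlambda01 : forall n, (0 < n)%N -> 0 < lambda n < 1)
  (hlambda_lower : n%:R * lambda n / ln n%:R @[n --> \oo] --> +oo)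
  (hlambda_upper : (lambda : nat -> R^o) =o_\oo (fun n => (ln n%:R)^-1 : R^o))
  (f : R -> R)
  (hf_cont : {within `[- 2^-1, 2^-1[, continuous f})
  (hf_per : f x @[x --> 2^-1^'-] --> f (- 2^-1))
  (hf_pos : (0 < ess_inf
     (mrestr lebesgue_measure (measurable_itv `[- 2^-1 : R, 2^-1[))%R
     (EFin \o f))%E)
  (C kappa : R) (hC : 0 < C) (hkappa : 0 < kappa)
  (hf_coef : forall h : int,
     `| fourier_coef f h | <= (C * (1 + `|h|%:~R) `^ (- (1 + kappa)))%:C)
  (Sigma : forall n : nat, 'M[R]_n)
  (hSigma : forall n, (0 < n)%N ->
     map_mx (real_complex R) (Sigma n)
     = \matrix_(i, j) fourier_coef f (Posz j - Posz i))
  (hSigma_cov : forall n, (0 < n)%N -> is_covariance (Sigma n))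
  (P : forall n : nat, 'cV[R]_n -> probability (n.-tuple R) R)
  (hP : forall n (mu : 'cV[R]_n), (0 < n)%N -> is_gaussian mu (Sigma n) (P n mu))
  (Delta : nat -> R) (hDelta : forall n, (0 < n)%N -> 0 < Delta n)
  (eps : nat -> R)
  (heps0 : eps n @[n --> \oo] --> 0)
  (heps : eps n * Num.sqrt (- ln (lambda n)) - Num.sqrt (ln (ln n%:R))
            @[n --> \oo] --> +oo)
  (hsep : \forall n \near \oo,
     Delta n * inf [set (Num.floor (n%:R * lambda n))%:~R
                        / Num.sqrt (sigma (Sigma n) I)
                   | I in intervals (lambda n)]
     >= (Num.sqrt 2 + eps n) * Num.sqrt (- ln (lambda n))) :
  exists c : nat -> R,
    (forall n, (0 < n)%N ->
       (alpha_err (P n) (scan_test (Sigma n) (lambda n) (c n))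
          <= alpha%:E)%E)
    /\ (limn_esup (fun n => beta_err (P n) (lambda n) (Delta n)
                        (scan_test (Sigma n) (lambda n) (c n)))
          <= alpha%:E)%E.
Proof.
have [c0 [M [c00 M0 spec]]] := covariance_spectral_bounds hf_cont hf_per hf_pos.
have {}spec (n : nat) (v : 'cV[R]_n) : (0 < n)%N ->
    c0 * (\sum_i v i 0 ^+ 2) <= qform (Sigma n) v v <= M * (\sum_i v i 0 ^+ 2).
  by move=> n0; apply: spec; exact: hSigma.
pose K := 64 / alpha + 4 * Num.sqrt (M / c0).
pose level_ok n c := (alpha_err (P n) (scan_test (Sigma n) (lambda n) c) <= alpha%:E)%E.
pose thr n := scan_threshold (lambda n) n K.
have /choice[c hc] : forall n, exists c : R,
    (0 < n)%N -> level_ok n c /\ (level_ok n (thr n) -> c = thr n).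
  move=> n; case: (posnP n) => [->|n0]; first by exists 0.
  have [ok|nok] := pselect (level_ok n (thr n)); first by exists (thr n).
  have /andP[lam0 _] := hlambda01 _ n0; have /andP[al0 _] := halpha.
  have [c hc] := exists_level_threshold n0 lam0 al0 (hP _ 0 n0) (hSigma_cov _ n0).
  by exists c => _; split.
exists c; split; first by move=> n n0; case: (hc n n0).
apply: limn_esup_le_near.
have /cvgryPge hlow := hlambda_lower.
have /cvgryPge hep := heps.
have hup := (eqoP _ _ _).1 hlambda_upper 1 ltr01.
have half0 : 0 < 1 / 2 :> R by lra.
have /cvgrPdist_le/(_ _ half0) he12 := heps0.
near=> n.
(* n >= e ^ e makes ln ln n at least 1. *)
have n1 : expR (expR 1) <= n%:R :> R by near: n; exact: nbhs_infty_ger.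
have n0 : (0 < n)%N by rewrite -(ltr_nat R) (lt_le_trans (expR_gt0 _) n1).
have nR : 0 < n%:R :> R by rewrite ltr0n.
have l1 : expR 1 <= ln n%:R :> R by rewrite -ler_expR lnK.
have l0 : 0 < ln n%:R :> R by exact: lt_le_trans (expR_gt0 _) l1.
have ll1 : 1 <= ln (ln n%:R) :> R by rewrite -ler_expR lnK.
have /andP[lam0 lam1] := hlambda01 _ n0.
have nlam : 3 * ln n%:R <= n%:R * lambda n.
  by rewrite -ler_pdivlMr//; near: n; exact: hlow.
have lamln : lambda n * ln n%:R <= 1.
  rewrite -ler_pdivlMr// mul1r.
  have : `|lambda n| <= 1 * `|(ln n%:R)^-1| by near: n.
  by rewrite mul1r !gtr0_norm ?invr_gt0.
have nal : 16 / alpha <= n%:R by near: n; exact: nbhs_infty_ger.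
have ok : level_ok n (thr n).
  apply: scan_size => //; [exact: hP|exact: hSigma_cov|by move=> v; exact: spec].
have [_ /(_ ok) ->] := hc n n0.
apply: (scan_power (c0 := c0) (e := eps n)) => //.
- by move=> mu; exact: hP.
- exact: hSigma_cov.
- by move=> v; have /andP[] := spec n v n0.
- exact: hDelta.
- by have : `|0 - eps n| <= 1 / 2; [near: n|rewrite sub0r normrN].
- by near: n; exact: hep.
- by near: n.
Unshelve. all: by end_near. Qed.
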